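(* Let $T>0$, $\Omega=[x_L,x_R]\subset\mathbb{R}$ a bounded interval, $K=[0,T]\times\Omega$, $\Phi$ a smooth potential, and $\lambda_1,\lambda_2>0$ fixed. Let $G:K\to\mathbb{R}$ be a given fixed function (the Stage 1 output $\partial_x m_2^{\mathrm{NN},\mathrm{stage1}}$). Let $(m_0,m_1)$, with $m_0,m_1\in C^1(K)$, be the solution of the moment system $$\partial_t m_0+\partial_x m_1=0,\qquad \partial_t m_1+G=-m_0\,\partial_x\Phi\qquad\text{on }K,$$ with initial profiles $(m_0(0,\cdot),m_1(0,\cdot))$ and periodic boundary conditions $m_k(t,x_L)=m_k(t,x_R)$ for $t\in[0,T]$, $k=0,1$. For neural networks $m_k^{\mathrm{NN}}(t,x)=m_k^{\mathrm{NN}}(t,x;n,w,b)$, $k=0,1$, with a $C^1$ activation function, where $n,w,b$ are the numbers of nodes, the weights and the biases, define $$E(t)=\frac12\int_\Omega\Big((m_0^{\mathrm{NN}}(t,x)-m_0(t,x))^2+(m_1^{\mathrm{NN}}(t,x)-m_1(t,x))^2\Big)\,dx .$$ Then for any $t\in[0,T]$, $E(t)\to 0$ if $$\mathrm{Loss}_{\mathrm{stage2}}(m_0^{\mathrm{NN}},m_1^{\mathrm{NN}})\to 0\quad\text{and}\quad \|m_0^{\mathrm{NN}}-m_0\|_{L^1([0,t];\dot H^1(\Omega))}\to 0 .$$ That is, for any $t\in[0,T]$ and any sequence of pairs of such networks along which the loss tends to $0$ and this norm tends to $0$, the corresponding values $E(t)$ tend to $0$.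
   Context: Neural networks: $m_k^{\mathrm{NN}}(t,x;n,w,b)$ is a fully connected feed-forward neural network with input $(t,x)$ and scalar output, i.e. obtained by alternating affine maps (with entries given by the weights $w$ and biases $b$) with componentwise application of the activation function. Loss: for a pair $(p_0,p_1)$ of $C^1$ functions on $K$ (approximating $(m_0,m_1)$), $$\mathrm{Loss}_{\mathrm{stage2}}(p_0,p_1)=\mathrm{Loss}_{\mathrm{GE}}+\lambda_1\mathrm{Loss}_{\mathrm{BC}}+\lambda_2\mathrm{Loss}_{\mathrm{IC}},$$ where $$\mathrm{Loss}_{\mathrm{GE}}=\int_0^T\!\!\int_\Omega |\partial_t p_0+\partial_x p_1|^2\,dx\,dt+\int_0^T\!\!\int_\Omega |\partial_t p_1+G+p_0\,\partial_x\Phi|^2\,dx\,dt,$$ $$\mathrm{Loss}_{\mathrm{BC}}=\int_0^T |p_0(s,x_L)-p_0(s,x_R)|^2\,ds+\int_0^T |p_1(s,x_L)-p_1(s,x_R)|^2\,ds,$$ $$\mathrm{Loss}_{\mathrm{IC}}=\int_\Omega |p_0(0,x)-m_0(0,x)|^2\,dx+\int_\Omega |p_1(0,x)-m_1(0,x)|^2\,dx .$$ In the paper the loss is written $\mathrm{Loss}_{\mathrm{stage2}}(\theta)$, with $\theta$ the network parameters. Norm: $\|f\|_{L^1([0,t];\dot H^1(\Omega))}=\int_0^t\|\partial_x f(s,\cdot)\|_{L^2(\Omega)}\,ds$. *)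

(* Defs.v *)
From Stdlib Require Import Reals.
From Coquelicot Require Import Coquelicot.
Local Open Scope R_scope.

Definition Icc (a b x : R) : Prop := a <= x <= b.

(* Derivatives relative to a set: one-sided at the end points of an interval,
   the usual [is_derive] in its interior. *)
Definition is_derive_on (D : R -> Prop) (f : R -> R) (x l : R) : Prop :=
  filterdiff f (within D (locally x)) (fun h : R => scal h l).

Definition ex_derive_on (D : R -> Prop) (f : R -> R) (x : R) : Prop :=
  exists l : R, is_derive_on D f x l.

Definition Derive_on (D : R -> Prop) (f : R -> R) (x : R) : R :=
  iota (fun l : R => is_derive_on D f x l).

(* A function on K = [0,T] x [xL,xR] is represented by a total function of
   (t,x); everything below depends only on its values on K. *)
Definition K (T xL xR : R) (z : R * R) : Prop :=
  Icc 0 T (fst z) /\ Icc xL xR (snd z).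

Definition dt (T : R) (f : R -> R -> R) (t x : R) : R :=
  Derive_on (Icc 0 T) (fun s : R => f s x) t.

Definition dx (xL xR : R) (f : R -> R -> R) (t x : R) : R :=
  Derive_on (Icc xL xR) (fun y : R => f t y) x.

Fixpoint Ck (T xL xR : R) (k : nat) (f : R -> R -> R) : Prop :=
  continuous_on (K T xL xR) (fun z : R * R => f (fst z) (snd z)) /\
  match k with
  | O => True
  | S k' =>
      (forall t x : R, K T xL xR (t, x) ->
         ex_derive_on (Icc 0 T) (fun s : R => f s x) t /\
         ex_derive_on (Icc xL xR) (fun y : R => f t y) x) /\
      Ck T xL xR k' (dt T f) /\ Ck T xL xR k' (dx xL xR f)
  end.

Definition smooth (T xL xR : R) (f : R -> R -> R) : Prop :=
  forall k : nat, Ck T xL xR k f.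

(* [network m]: fully connected networks with m inputs and a scalar output.
   Hidden layers have S n nodes: besides excluding empty layers, this keeps
   away from [Mmult] at inner dimension 0, where it still sums one term. *)
Inductive network : nat -> Type :=
| output_layer (m : nat) (W : @matrix R 1 m) (b : @matrix R 1 1) : network m
| hidden_layer (m n : nat) (W : @matrix R (S n) m) (b : @matrix R (S n) 1)
    (N : network (S n)) : network m.

Definition affine {m n : nat} (W : @matrix R n m) (b : @matrix R n 1)
    (v : @matrix R m 1) : @matrix R n 1 :=
  Mplus (Mmult W v) b.

Definition componentwise {n : nat} (sigma : R -> R) (v : @matrix R n 1) :
    @matrix R n 1 :=
  mk_matrix n 1 (fun i j => sigma (coeff_mat 0 v i j)).

Fixpoint eval (sigma : R -> R) {m : nat} (N : network m) :
    @matrix R m 1 -> R :=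
  match N in network m return @matrix R m 1 -> R with
  | output_layer _ W b => fun v => coeff_mat 0 (affine W b v) 0 0
  | hidden_layer _ _ W b N' =>
      fun v => eval sigma N' (componentwise sigma (affine W b v))
  end.

Definition realize (sigma : R -> R) (N : network 2) (t x : R) : R :=
  eval sigma N (mk_matrix 2 1 (fun i _ => match i with O => t | _ => x end)).

Definition loss_GE (T xL xR : R) (Phi G p0 p1 : R -> R -> R) : R :=
  RInt (fun t => RInt (fun x =>
    Rabs (dt T p0 t x + dx xL xR p1 t x) ^ 2) xL xR) 0 T +
  RInt (fun t => RInt (fun x =>
    Rabs (dt T p1 t x + G t x + p0 t x * dx xL xR Phi t x) ^ 2) xL xR) 0 T.

Definition loss_BC (T xL xR : R) (p0 p1 : R -> R -> R) : R :=
  RInt (fun s => Rabs (p0 s xL - p0 s xR) ^ 2) 0 T +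
  RInt (fun s => Rabs (p1 s xL - p1 s xR) ^ 2) 0 T.

Definition loss_IC (xL xR : R) (m0 m1 p0 p1 : R -> R -> R) : R :=
  RInt (fun x => Rabs (p0 0 x - m0 0 x) ^ 2) xL xR +
  RInt (fun x => Rabs (p1 0 x - m1 0 x) ^ 2) xL xR.

Definition loss_stage2 (T xL xR lambda1 lambda2 : R)
    (Phi G m0 m1 p0 p1 : R -> R -> R) : R :=
  loss_GE T xL xR Phi G p0 p1 + lambda1 * loss_BC T xL xR p0 p1
  + lambda2 * loss_IC xL xR m0 m1 p0 p1.

Definition norm_L1_H1dot (xL xR t : R) (f : R -> R -> R) : R :=
  RInt (fun s => sqrt (RInt (fun x => Rabs (dx xL xR f s x) ^ 2) xL xR)) 0 t.

Definition energy (xL xR : R) (m0 m1 p0 p1 : R -> R -> R) (t : R) : R :=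
  1 / 2 * RInt (fun x => (p0 t x - m0 t x) ^ 2 + (p1 t x - m1 t x) ^ 2) xL xR.

(* Main.v *)
Require Import Defs.
From Stdlib Require Import Reals Lra Lia.
From Coquelicot Require Import Coquelicot.
Local Open Scope R_scope.

(* Let e_k be the errors, r_0 = dt e_0 + dx e_1 and r_1 = dt e_1 + e_0 dx Phi the
   residuals, d_k the jump of e_k between the two end points of Omega, and g the
   L^2 norm of dx e_0.  Integrating by parts in dE/dt leaves the boundary terms
   d_0 e_1(xR) and e_0(xL) d_1, and no norm of dx e_1 is available to bound the
   trace of e_1.  The multiplier q, affine with q(xL) = 0 and q(xR) = 1, helps:
   d/dt of the integral of q e_0 e_1 contains -e_1(xR)^2 / 2 plus terms of the
   order of E and the residuals.  So F = E + 1/2 int q e_0 e_1, which lies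
   between E/2 and 3E/2, absorbs d_0 e_1(xR), while the trace e_0(xL)^2 is
   bounded by int e_0^2 and g |e_0|_2.  This gives
   F' <= (4 C + 2 g) F + |r_0|^2 + |r_1|^2 + d_0^2 + d_1^2 + g,
   and Gronwall's inequality concludes. *)

(** * Jointly continuous functions and their integrals *)

Definition jcont (f : R -> R -> R) : Prop :=
  forall t x, continuity_2d_pt f t x.

Lemma jcont_const (c : R) : jcont (fun _ _ => c).
Proof. intros t x. apply continuity_2d_pt_const. Qed.

Lemma jcont_fst : jcont (fun t _ => t).
Proof. intros t x. apply continuity_2d_pt_id1. Qed.

Lemma jcont_snd : jcont (fun _ x => x).
Proof. intros t x. apply continuity_2d_pt_id2. Qed.

Lemma jcont_plus (f g : R -> R -> R) :
  jcont f -> jcont g -> jcont (fun t x => f t x + g t x).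
Proof. intros hf hg t x. now apply continuity_2d_pt_plus. Qed.

Lemma jcont_minus (f g : R -> R -> R) :
  jcont f -> jcont g -> jcont (fun t x => f t x - g t x).
Proof. intros hf hg t x. now apply continuity_2d_pt_minus. Qed.

Lemma jcont_mult (f g : R -> R -> R) :
  jcont f -> jcont g -> jcont (fun t x => f t x * g t x).
Proof. intros hf hg t x. now apply continuity_2d_pt_mult. Qed.

Lemma jcont_pow (f : R -> R -> R) (n : nat) :
  jcont f -> jcont (fun t x => f t x ^ n).
Proof.
  intros hf. induction n as [|n IH]; simpl.
  - apply jcont_const.
  - now apply jcont_mult.
Qed.

Lemma jcont_comp (s : R -> R) (f : R -> R -> R) :
  (forall y, continuous s y) -> jcont f -> jcont (fun t x => s (f t x)).
Proof.
  intros hs hf t x. apply (continuity_1d_2d_pt_comp s f); [|apply hf].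
  apply continuity_pt_filterlim, hs.
Qed.

Ltac jc := repeat first
  [ assumption | apply jcont_const | apply jcont_pow | apply jcont_minus
  | apply jcont_plus | apply jcont_mult | apply jcont_snd | apply jcont_fst ].

Lemma jcont_continuous_snd (f : R -> R -> R) (t x : R) :
  jcont f -> continuous (f t) x.
Proof.
  intros hf.
  apply (continuous_comp_2 (fun _ : R => t) (fun y : R => y) f).
  - apply continuous_const.
  - apply continuous_id.
  - apply continuity_2d_pt_filterlim, hf.
Qed.

Lemma jcont_continuous_fst (f : R -> R -> R) (t x : R) :
  jcont f -> continuous (fun s => f s x) t.
Proof.
  intros hf.
  apply (continuous_comp_2 (fun s : R => s) (fun _ : R => x) f).
  - apply continuous_id.
  - apply continuous_const.
  - apply continuity_2d_pt_filterlim, hf.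
Qed.

Lemma ex_RInt_cont (f : R -> R) (a b : R) :
  (forall x, continuous f x) -> ex_RInt f a b.
Proof. intros hf. apply (ex_RInt_continuous (V := R_CompleteNormedModule)). auto. Qed.

Lemma ex_RInt_jcont (f : R -> R -> R) (t a b : R) :
  jcont f -> ex_RInt (f t) a b.
Proof. intros hf. apply ex_RInt_cont. intros x. now apply jcont_continuous_snd. Qed.

(** This and the next four lemmas are stated with the operations of [R] instead of the module
    operations [plus], [minus] and [scal], so that [rewrite] and [lra] work on the resulting
    terms. *)
Lemma RInt_plusR (f g : R -> R) (a b : R) :
  ex_RInt f a b -> ex_RInt g a b ->
  RInt (fun x => f x + g x) a b = RInt f a b + RInt g a b.
Proof. exact (RInt_plus (V := R_CompleteNormedModule) f g a b). Qed.

Lemma RInt_minusR (f g : R -> R) (a b : R) :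
  ex_RInt f a b -> ex_RInt g a b ->
  RInt (fun x => f x - g x) a b = RInt f a b - RInt g a b.
Proof. exact (RInt_minus (V := R_CompleteNormedModule) f g a b). Qed.

Lemma RInt_scalR (f : R -> R) (a b l : R) :
  ex_RInt f a b -> RInt (fun x => l * f x) a b = l * RInt f a b.
Proof. exact (RInt_scal (V := R_CompleteNormedModule) f a b l). Qed.

Lemma ex_RInt_plusR (f g : R -> R) (a b : R) :
  ex_RInt f a b -> ex_RInt g a b -> ex_RInt (fun x => f x + g x) a b.
Proof. exact (ex_RInt_plus (V := R_NormedModule) f g a b). Qed.

Lemma ex_RInt_scalR (f : R -> R) (a b l : R) :
  ex_RInt f a b -> ex_RInt (fun x => l * f x) a b.
Proof. exact (ex_RInt_scal (V := R_NormedModule) f a b l). Qed.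

Lemma continuous_RInt_param (f : R -> R -> R) (a b t : R) :
  a <= b -> jcont f -> continuous (fun s => RInt (f s) a b) t.
Proof.
  intros hab hf. apply filterlim_locally. intros eps.
  (* Uniform continuity on a compact neighbourhood of the slice makes the modulus independent of
     [x]. The extra 1 in the tolerance keeps the divisor positive when [a = b] and makes the final
     inequality strict. *)
  destruct (uniform_continuity_2d f (t - 1) (t + 1) a b (fun s x _ _ => hf s x)
    (mkposreal (eps / (b - a + 1)) ltac:(apply Rdiv_lt_0_compat; [apply eps|lra])))
    as [d hd]. simpl in hd.
  assert (hd1 : 0 < Rmin d 1) by (apply Rmin_case; [apply d|lra]).
  exists (mkposreal _ hd1). intros s hs.
  change (Rabs (s - t) < Rmin d 1) in hs.
  pose proof (Rmin_l d 1). pose proof (Rmin_r d 1).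
  assert (hs1 : t - 1 <= s <= t + 1).
  { assert (Rabs (s - t) < 1) as h by lra. apply Rabs_def2 in h. lra. }
  change (Rabs (RInt (f s) a b - RInt (f t) a b) < eps).
  rewrite <- RInt_minusR; try (now apply ex_RInt_jcont).
  apply Rle_lt_trans with ((b - a) * (eps / (b - a + 1))).
  - apply abs_RInt_le_const; [exact hab| |].
    + apply (ex_RInt_minus (V := R_NormedModule)); now apply ex_RInt_jcont.
    + intros x hx. left. apply hd; try lra.
      * replace (x - x) with 0 by ring. rewrite Rabs_R0. apply d.
  - pose proof (cond_pos eps).
    apply Rlt_le_trans with ((b - a + 1) * (eps / (b - a + 1))).
    + apply Rmult_lt_compat_r; [|lra]. apply Rdiv_lt_0_compat; lra.
    + right. field. lra.
Qed.

Lemma is_derive_RInt_jcont (f ft : R -> R -> R) (T a b t : R) :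
  a <= b -> jcont f -> jcont ft ->
  (forall s x, 0 < s < T -> is_derive (fun u => f u x) s (ft s x)) ->
  0 < t < T ->
  is_derive (fun s => RInt (f s) a b) t (RInt (ft t) a b).
Proof.
  intros hab hf hft hd ht.
  assert (hloc : locally t (fun s => 0 < s < T)).
  { apply filter_and; [apply open_gt|apply open_lt]; lra. }
  rewrite (RInt_ext (ft t) (fun x => Derive (fun u => f u x) t)).
  2:{ intros x _. symmetry. apply is_derive_unique. now apply hd. }
  apply (is_derive_RInt_param f).
  - revert hloc. apply filter_imp. intros s hs x _. exists (ft s x). now apply hd.
  - intros x _. apply continuity_2d_pt_ext_loc with ft; [|apply hft].
    destruct hloc as [d hd']. exists d. intros u v hu hv.
    symmetry. apply is_derive_unique, hd, hd'. exact hu.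
  - apply filter_forall. intros s. now apply ex_RInt_jcont.
Qed.

(** * Monotonicity, primitives and Gronwall's inequality *)

Lemma nonincreasing_of_derive (f df : R -> R) (a b : R) :
  a <= b -> (forall x, continuous f x) ->
  (forall x, a < x < b -> is_derive f x (df x)) ->
  (forall x, a < x < b -> df x <= 0) -> f b <= f a.
Proof.
  intros hab hc hd hneg.
  (* The intermediate point supplied by [MVT_gen] may be an end point, where nothing is known about
     [df]; after extension by 0 the sign holds there too. *)
  set (g := fun x => if Rlt_dec a x then if Rlt_dec x b then df x else 0 else 0).
  assert (hg : forall x, g x <= 0).
  { intros x. unfold g. destruct (Rlt_dec a x); [destruct (Rlt_dec x b)|]; try lra.
    apply hneg. lra. }
  destruct (MVT_gen f a b g) as [c [_ hc2]].
  - rewrite Rmin_left, Rmax_right by lra. intros x hx. unfold g.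
    destruct (Rlt_dec a x); [destruct (Rlt_dec x b)|]; try lra. now apply hd.
  - intros x _. apply continuity_pt_filterlim, hc.
  - specialize (hg c). nra.
Qed.

Lemma is_derive_RInt_cont (f : R -> R) (a x : R) :
  (forall y, continuous f y) -> is_derive (fun y => RInt f a y) x (f x).
Proof.
  intros hf. apply (is_derive_RInt f _ a x); [|apply hf].
  apply filter_forall. intros y.
  apply (RInt_correct (V := R_CompleteNormedModule)). now apply ex_RInt_cont.
Qed.

Lemma continuous_of_is_derive (f : R -> R) (x l : R) :
  is_derive f x l -> continuous f x.
Proof. intros h. apply (ex_derive_continuous f). now exists l. Qed.

(** The difference between [f] and the primitive of [df] has derivative 0 inside the interval and is
    continuous up to the end points, so it is nonincreasing, and so is its opposite. *)
Lemma RInt_derive_interior (f df : R -> R) (a b : R) :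
  a <= b -> (forall x, continuous f x) -> (forall x, continuous df x) ->
  (forall x, a < x < b -> is_derive f x (df x)) ->
  RInt df a b = f b - f a.
Proof.
  intros hab hf hdf hd.
  assert (hI : forall x, is_derive (fun y => RInt df a y) x (df x)).
  { intros x. now apply is_derive_RInt_cont. }
  assert (hIc : forall x, continuous (fun y => RInt df a y) x).
  { intros x. apply (continuous_of_is_derive _ _ _ (hI x)). }
  assert (RInt df a a = 0) as h0 by exact (RInt_point a df).
  assert (h1 : f b - RInt df a b <= f a - RInt df a a).
  { apply (nonincreasing_of_derive (fun x => f x - RInt df a x) (fun x => df x - df x));
      [exact hab| | |intros; lra].
    - intros x. apply (continuous_minus (V := R_NormedModule)); auto.
    - intros x hx. apply (is_derive_minus (V := R_NormedModule)); auto. }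
  assert (h2 : RInt df a b - f b <= RInt df a a - f a).
  { apply (nonincreasing_of_derive (fun x => RInt df a x - f x) (fun x => df x - df x));
      [exact hab| | |intros; lra].
    - intros x. apply (continuous_minus (V := R_NormedModule)); auto.
    - intros x hx. apply (is_derive_minus (V := R_NormedModule)); auto. }
  lra.
Qed.

(** With [kap] and [H] the primitives of [k] and [h], the derivative of exp(-kap) F - H is at most
    (exp(-kap) - 1) h. This is nonpositive since kap >= 0 on [0,t] and h >= 0, so comparing the
    values at 0 and [t] gives the bound. *)
Lemma gronwall (F dF k h : R -> R) (t : R) :
  0 <= t -> (forall s, continuous F s) ->
  (forall s, continuous k s) -> (forall s, continuous h s) ->
  (forall s, 0 <= k s) -> (forall s, 0 <= h s) ->
  (forall s, 0 < s < t -> is_derive F s (dF s)) ->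
  (forall s, 0 < s < t -> dF s <= k s * F s + h s) ->
  F t <= exp (RInt k 0 t) * (F 0 + RInt h 0 t).
Proof.
  intros ht hF hk hh hk0 hh0 hd hle.
  set (kap := fun s => RInt k 0 s). set (H := fun s => RInt h 0 s).
  assert (hkap : forall s, is_derive kap s (k s)) by (intros; now apply is_derive_RInt_cont).
  assert (hH : forall s, is_derive H s (h s)) by (intros; now apply is_derive_RInt_cont).
  assert (hexp : forall s, is_derive (fun u => exp (- kap u)) s (- k s * exp (- kap s))).
  { intros s. evar_last.
    - apply (is_derive_comp exp (fun u => - kap u)).
      + apply is_derive_exp.
      + apply (is_derive_opp kap), hkap.
    - reflexivity. }
  assert (hkap0 : forall s, 0 <= s -> 0 <= kap s).
  { intros s hs. apply RInt_ge_0; [exact hs|now apply ex_RInt_cont|auto]. }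
  assert (h1 : exp (- kap t) * F t - H t <= exp (- kap 0) * F 0 - H 0).
  { apply (nonincreasing_of_derive (fun s => exp (- kap s) * F s - H s)
      (fun s => (- k s * exp (- kap s) * F s + exp (- kap s) * dF s) - h s) 0 t ht).
    - intros s. apply (continuous_minus (V := R_NormedModule)).
      + apply (continuous_mult (K := R_AbsRing)); [|apply hF].
        apply (continuous_of_is_derive _ _ _ (hexp s)).
      + apply (continuous_of_is_derive _ _ _ (hH s)).
    - intros s hs. apply (is_derive_minus (V := R_NormedModule)); [|apply hH].
      apply (is_derive_mult (K := R_AbsRing) (fun s => exp (- kap s)) F);
        [apply hexp|now apply hd|exact Rmult_comm].
    - intros s hs. specialize (hle s hs). specialize (hh0 s).
      assert (0 < exp (- kap s)) by apply exp_pos.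
      assert (exp (- kap s) <= 1).
      { rewrite <- exp_0. destruct (Req_dec (kap s) 0) as [->|hne].
        - rewrite Ropp_0. lra.
        - left. apply exp_increasing. specialize (hkap0 s ltac:(lra)). lra. }
      nra. }
  assert (hkz : kap 0 = 0) by exact (RInt_point 0 k).
  assert (hHz : H 0 = 0) by exact (RInt_point 0 h).
  rewrite hkz, hHz, Ropp_0, exp_0 in h1.
  fold (kap t) (H t).
  apply Rle_trans with (exp (kap t) * (exp (- kap t) * F t)).
  - rewrite <- Rmult_assoc, <- exp_plus, Rplus_opp_r, exp_0. lra.
  - apply Rmult_le_compat_l; [left; apply exp_pos|lra].
Qed.

(** * Integrals of squares *)

Lemma continuous_sq (f : R -> R) :
  (forall x, continuous f x) -> forall x, continuous (fun y => f y ^ 2) x.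
Proof.
  intros hf x. apply (continuous_comp f (fun y => y ^ 2)); [apply hf|].
  apply (ex_derive_continuous (fun y : R => y ^ 2)). auto_derive. exact I.
Qed.

Lemma continuous_RInt_sq (f : R -> R -> R) (a b s : R) :
  a <= b -> jcont f -> continuous (fun s => RInt (fun x => f s x ^ 2) a b) s.
Proof. intros hab hf. apply (continuous_RInt_param (fun s x => f s x ^ 2)); [exact hab|jc]. Qed.

Lemma RInt_sq_ge_0 (f : R -> R) (a b : R) :
  a <= b -> (forall x, continuous f x) -> 0 <= RInt (fun x => f x ^ 2) a b.
Proof.
  intros hab hf. apply RInt_ge_0; [exact hab| |intros; apply pow2_ge_0].
  apply ex_RInt_cont, continuous_sq, hf.
Qed.

Lemma RInt_RInt_sq_ge_0 (f : R -> R -> R) (T a b : R) :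
  0 <= T -> a <= b -> jcont f -> 0 <= RInt (fun s => RInt (fun x => f s x ^ 2) a b) 0 T.
Proof.
  intros hT hab hf. apply RInt_ge_0; [exact hT| |].
  - apply ex_RInt_cont. intros s. now apply continuous_RInt_sq.
  - intros s _. apply (RInt_sq_ge_0 (f s)); [exact hab|].
    intros x. now apply jcont_continuous_snd.
Qed.

Lemma RInt_nonneg_le (f : R -> R) (t T : R) :
  0 <= t <= T -> (forall s, continuous f s) -> (forall s, 0 <= f s) ->
  RInt f 0 t <= RInt f 0 T.
Proof.
  intros ht hf hf0.
  assert (hC : RInt f 0 t + RInt f t T = RInt f 0 T)
    by (apply (RInt_Chasles (V := R_CompleteNormedModule)); now apply ex_RInt_cont).
  assert (0 <= RInt f t T) by (apply RInt_ge_0; [lra|now apply ex_RInt_cont|auto]).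
  lra.
Qed.

Definition L2norm (a b : R) (f : R -> R) : R := sqrt (RInt (fun x => f x ^ 2) a b).

(* Cauchy-Schwarz followed by 2 sqrt y <= 1 + y, in the form Gronwall needs. *)
Lemma RInt_mult_le_L2norm (f h : R -> R) (a b : R) :
  a <= b -> (forall x, continuous f x) -> (forall x, continuous h x) ->
  RInt (fun x => f x * h x) a b <=
    L2norm a b f / 2 * (1 + RInt (fun x => h x ^ 2) a b).
Proof.
  intros hab hf hh.
  assert (hfi := ex_RInt_cont _ a b (continuous_sq f hf)).
  assert (hhi := ex_RInt_cont _ a b (continuous_sq h hh)).
  (* Young's inequality with a free weight [mu]: the difference of the integrands is (f - mu h)^2 /
     (2 mu). *)
  assert (hmu : forall mu, 0 < mu -> RInt (fun x => f x * h x) a b <=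
    / (2 * mu) * RInt (fun x => f x ^ 2) a b + mu / 2 * RInt (fun x => h x ^ 2) a b).
  { intros mu hmu.
    rewrite <- !RInt_scalR by assumption.
    rewrite <- RInt_plusR by
      (apply (ex_RInt_scal (V := R_NormedModule)); assumption).
    apply RInt_le; [exact hab| | |].
    - apply ex_RInt_cont. intros x. now apply (continuous_mult (K := R_AbsRing)).
    - apply (ex_RInt_plus (V := R_NormedModule));
        apply (ex_RInt_scal (V := R_NormedModule)); assumption.
    - intros x _. apply Rminus_le_0.
      replace (_ - _) with (/ (2 * mu) * (f x - mu * h x) ^ 2) by (field; lra).
      apply Rmult_le_pos; [left; apply Rinv_0_lt_compat; lra|apply pow2_ge_0]. }
  assert (hf0 : 0 <= RInt (fun x => f x ^ 2) a b).
  { apply RInt_ge_0; auto. intros; apply pow2_ge_0. }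
  assert (hh0 : 0 <= RInt (fun x => h x ^ 2) a b).
  { apply RInt_ge_0; auto. intros; apply pow2_ge_0. }
  unfold L2norm. set (A := RInt (fun x => f x ^ 2) a b) in *.
  set (B := RInt (fun x => h x ^ 2) a b) in *.
  (* The weight that yields the claim is [mu] = [sqrt A]. When this vanishes, only the term mu B / 2
     remains, and it is made smaller than any [eps]. *)
  destruct (sqrt_pos A) as [hg|hg].
  - apply Rle_trans with (1 := hmu _ hg). right.
    assert (hA : A = sqrt A * sqrt A) by (now rewrite sqrt_sqrt).
    set (g := sqrt A) in *. rewrite hA. field. lra.
  - assert (hA : A = 0) by (apply sqrt_eq_0; auto).
    rewrite <- hg, hA in *. apply le_epsilon. intros eps heps.
    specialize (hmu (eps / (1 + B)) ltac:(apply Rdiv_lt_0_compat; lra)).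
    apply Rle_trans with (1 := hmu).
    assert (eps / (1 + B) * (1 + B) = eps) by (field; lra).
    assert (0 < eps / (1 + B)) by (apply Rdiv_lt_0_compat; lra).
    nra.
Qed.

(** * Functions of class C^1 on a rectangle *)

(* Continuity is required on the whole plane, differentiability only where the
   differentiated variable is interior: this is the regularity that remains after
   extending a function on K by projecting the plane onto K. *)
Record C1_rect (T xL xR : R) (f ft fx : R -> R -> R) : Prop := {
  C1_jcont : jcont f;
  C1_jcont_t : jcont ft;
  C1_jcont_x : jcont fx;
  C1_der_t : forall t x, 0 < t < T -> is_derive (fun s => f s x) t (ft t x);
  C1_der_x : forall t x, xL < x < xR -> is_derive (f t) x (fx t x) }.

Lemma C1_rect_plus (T xL xR : R) (f ft fx g gt gx : R -> R -> R) :
  C1_rect T xL xR f ft fx -> C1_rect T xL xR g gt gx ->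
  C1_rect T xL xR (fun t x => f t x + g t x)
    (fun t x => ft t x + gt t x) (fun t x => fx t x + gx t x).
Proof.
  intros [f0 f1 f2 f3 f4] [g0 g1 g2 g3 g4]. split; try now apply jcont_plus.
  - intros t x ht. apply (is_derive_plus (V := R_NormedModule)); auto.
  - intros t x hx. apply (is_derive_plus (V := R_NormedModule)); auto.
Qed.

Lemma C1_rect_const (T xL xR c : R) :
  C1_rect T xL xR (fun _ _ => c) (fun _ _ => 0) (fun _ _ => 0).
Proof.
  split; try apply jcont_const; intros;
    apply (is_derive_const (V := R_NormedModule)).
Qed.

Lemma C1_rect_minus (T xL xR : R) (f ft fx g gt gx : R -> R -> R) :
  C1_rect T xL xR f ft fx -> C1_rect T xL xR g gt gx ->
  C1_rect T xL xR (fun t x => f t x - g t x)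
    (fun t x => ft t x - gt t x) (fun t x => fx t x - gx t x).
Proof.
  intros [f0 f1 f2 f3 f4] [g0 g1 g2 g3 g4]. split; try now apply jcont_minus.
  - intros t x ht. apply (is_derive_minus (V := R_NormedModule)); auto.
  - intros t x hx. apply (is_derive_minus (V := R_NormedModule)); auto.
Qed.

Lemma C1_rect_mult (T xL xR : R) (f ft fx g gt gx : R -> R -> R) :
  C1_rect T xL xR f ft fx -> C1_rect T xL xR g gt gx ->
  C1_rect T xL xR (fun t x => f t x * g t x)
    (fun t x => ft t x * g t x + f t x * gt t x)
    (fun t x => fx t x * g t x + f t x * gx t x).
Proof.
  intros [f0 f1 f2 f3 f4] [g0 g1 g2 g3 g4].
  split; try (apply jcont_plus); try now apply jcont_mult.
  - intros t x ht. apply (is_derive_mult (K := R_AbsRing) (fun s => f s x) (fun s => g s x));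
      auto. exact Rmult_comm.
  - intros t x hx. apply (is_derive_mult (K := R_AbsRing) (f t) (g t));
      auto. exact Rmult_comm.
Qed.

Lemma C1_rect_comp (T xL xR : R) (s : R -> R) (f ft fx : R -> R -> R) :
  (forall y, ex_derive s y /\ continuous (Derive s) y) ->
  C1_rect T xL xR f ft fx ->
  C1_rect T xL xR (fun t x => s (f t x))
    (fun t x => ft t x * Derive s (f t x)) (fun t x => fx t x * Derive s (f t x)).
Proof.
  intros hs [f0 f1 f2 f3 f4]. split.
  - apply jcont_comp; [|exact f0]. intros y. apply (ex_derive_continuous s), hs.
  - apply jcont_mult; [exact f1|]. apply jcont_comp; [apply hs|exact f0].
  - apply jcont_mult; [exact f2|]. apply jcont_comp; [apply hs|exact f0].
  - intros t x ht. apply (is_derive_comp (V := R_NormedModule) s (fun u => f u x)); auto.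
    apply Derive_correct, hs.
  - intros t x hx. apply (is_derive_comp (V := R_NormedModule) s (f t)); auto.
    apply Derive_correct, hs.
Qed.

Lemma C1_rect_affine (T xL xR a b : R) :
  C1_rect T xL xR (fun _ x => a * x + b) (fun _ _ => 0) (fun _ _ => a).
Proof.
  split; try apply jcont_const.
  - apply jcont_plus; [apply jcont_mult|]; try apply jcont_const. apply jcont_snd.
  - intros t x _. apply (is_derive_const (V := R_NormedModule)).
  - intros t x _. auto_derive; [exact I|ring].
Qed.

Lemma C1_rect_ext (T xL xR : R) (f ft fx g gt gx : R -> R -> R) :
  C1_rect T xL xR f ft fx -> (forall t x, f t x = g t x) ->
  (forall t x, ft t x = gt t x) -> (forall t x, fx t x = gx t x) ->
  C1_rect T xL xR g gt gx.
Proof.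
  intros [f0 f1 f2 f3 f4] h ht hx. split.
  - intros t x. now apply continuity_2d_pt_ext with f.
  - intros t x. now apply continuity_2d_pt_ext with ft.
  - intros t x. now apply continuity_2d_pt_ext with fx.
  - intros t x ht'. rewrite <- ht.
    apply (is_derive_ext (V := R_NormedModule) (fun s => f s x)); auto.
  - intros t x hx'. rewrite <- hx.
    apply (is_derive_ext (V := R_NormedModule) (f t)); auto.
Qed.

Lemma C1_rect_RInt_dx (T xL xR t : R) (f ft fx : R -> R -> R) :
  xL <= xR -> C1_rect T xL xR f ft fx ->
  RInt (fx t) xL xR = f t xR - f t xL.
Proof.
  intros hx [f0 f1 f2 f3 f4]. apply RInt_derive_interior; auto;
    intros x; now apply jcont_continuous_snd.
Qed.

(** * The energy estimate *)

(** The gap between the two sides is a combination of (u + v)^2 and (u - v)^2 with coefficients (B -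
    p)/4 and (B + p)/4, nonnegative because |p| <= B. *)
Lemma mult_le_weighted (B p u v : R) :
  Rabs p <= B -> p * (u * v) <= B / 2 * (u ^ 2 + v ^ 2).
Proof.
  intros hp. apply Rabs_le_between in hp. apply Rminus_le_0.
  replace (_ - _) with ((B - p) / 4 * (u + v) ^ 2 + (B + p) / 4 * (u - v) ^ 2) by field.
  assert (0 <= (u + v) ^ 2) by apply pow2_ge_0.
  assert (0 <= (u - v) ^ 2) by apply pow2_ge_0.
  nra.
Qed.

(** The function [phi] stands for dx Phi. No equation is imposed on the errors: residuals and jumps
    appear on the right as data. The constants 3 and 4 outside the exponential come from N/4 <= Q <=
    3N/4, where [Q] is the density of the modified energy and N = e0^2 + e1^2: passing from N to Q
    at time [t] costs 4, and at time 0 one gets 4 times 3/4. *)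
Lemma energy_estimate (T xL xR B t : R) (phi e0 a0 b0 e1 a1 b1 : R -> R -> R) :
  xL < xR -> 0 <= t <= T -> jcont phi ->
  (forall s x, xL <= x <= xR -> Rabs (phi s x) <= B) ->
  C1_rect T xL xR e0 a0 b0 -> C1_rect T xL xR e1 a1 b1 ->
  RInt (fun x => e0 t x ^ 2 + e1 t x ^ 2) xL xR <=
  exp (4 * (1 + B + / (xR - xL)) * t + 2 * RInt (fun s => L2norm xL xR (b0 s)) 0 t) *
  (3 * RInt (fun x => e0 0 x ^ 2 + e1 0 x ^ 2) xL xR +
   4 * (RInt (fun s => RInt (fun x => (a0 s x + b1 s x) ^ 2) xL xR) 0 t +
        RInt (fun s => RInt (fun x => (a1 s x + phi s x * e0 s x) ^ 2) xL xR) 0 t +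
        RInt (fun s => (e0 s xL - e0 s xR) ^ 2) 0 t +
        RInt (fun s => (e1 s xL - e1 s xR) ^ 2) 0 t +
        RInt (fun s => L2norm xL xR (b0 s)) 0 t)).
Proof.
  intros hx ht hphi hB H0 H1.
  assert (hx' : xL <= xR) by lra.
  set (iL := / (xR - xL)).
  assert (hiL : 0 < iL) by (apply Rinv_0_lt_compat; lra).
  set (C := 1 + B + iL).
  pose (q := fun x => iL * x + - (iL * xL)).
  assert (hqL : q xL = 0) by (unfold q; ring).
  assert (hqR : q xR = 1) by (unfold q, iL; field; lra).
  assert (hq : forall x, xL <= x <= xR -> 0 <= q x <= 1).
  { intros x hx1. rewrite <- hqL, <- hqR. unfold q. nra. }
  assert (Hq : C1_rect T xL xR (fun _ x => q x) (fun _ _ => 0) (fun _ _ => iL))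
    by apply C1_rect_affine.
  pose (Q := fun s x => 1 / 2 * (e0 s x * e0 s x + e1 s x * e1 s x + q x * (e0 s x * e1 s x))).
  pose (Qt := fun s x => e0 s x * a0 s x + e1 s x * a1 s x
     + 1 / 2 * q x * (a0 s x * e1 s x + e0 s x * a1 s x)).
  (* Only the time derivative of [Q] enters the estimate, so its space derivative is left to
     unification; likewise for the time derivatives of [bd] and [tr] below. *)
  assert (HQ : exists Qx, C1_rect T xL xR Q Qt Qx).
  { eexists. eapply (C1_rect_ext T xL xR Q).
    - apply C1_rect_mult; [apply C1_rect_const|].
      apply C1_rect_plus; [apply C1_rect_plus; apply C1_rect_mult; eassumption|].
      apply C1_rect_mult; [exact Hq|]. apply C1_rect_mult; eassumption.
    - intros s x. reflexivity.
    - intros s x. unfold Qt. field.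
    - intros s x. reflexivity. }
  destruct HQ as [Qx HQ].
  (* Chosen so that in [Qt] + [bdx] all terms in [b1] cancel once a0 = r0 - b1 and a1 = r1 - phi e0
     are substituted, with r0 and r1 the residuals: e0 b1 is cancelled by the first summand, q e1 b1
     / 2 by the second. *)
  pose (bd := fun s x => e0 s x * e1 s x + 1 / 4 * (q x * (e1 s x * e1 s x))).
  pose (bdx := fun s x => b0 s x * e1 s x + e0 s x * b1 s x
     + 1 / 4 * iL * e1 s x ^ 2 + 1 / 2 * q x * e1 s x * b1 s x).
  assert (Hbd : exists bdt, C1_rect T xL xR bd bdt bdx).
  { eexists. eapply (C1_rect_ext T xL xR bd).
    - apply C1_rect_plus; [apply C1_rect_mult; eassumption|].
      apply C1_rect_mult; [apply C1_rect_const|].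
      apply C1_rect_mult; [exact Hq|]. apply C1_rect_mult; eassumption.
    - intros s x. reflexivity.
    - intros s x. reflexivity.
    - intros s x. unfold bdx. field. }
  destruct Hbd as [bdt Hbd].
  (* The weight 1 - q is 1 at [xL] and 0 at [xR], so the integral of [trx] is exactly -e0(xL)^2. *)
  pose (tr := fun s x => (1 + -1 * q x) * (e0 s x * e0 s x)).
  pose (trx := fun s x => - iL * e0 s x ^ 2 + 2 * (1 - q x) * e0 s x * b0 s x).
  assert (Htr : exists trt, C1_rect T xL xR tr trt trx).
  { eexists. eapply (C1_rect_ext T xL xR tr).
    - apply C1_rect_mult; [|apply C1_rect_mult; eassumption].
      apply C1_rect_plus; [apply C1_rect_const|].
      apply C1_rect_mult; [apply C1_rect_const|exact Hq].
    - intros s x. reflexivity.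
    - intros s x. reflexivity.
    - intros s x. unfold trx. ring. }
  destruct Htr as [trt Htr].
  pose (g := fun s => L2norm xL xR (b0 s)).
  pose (rho0 := fun s => RInt (fun x => (a0 s x + b1 s x) ^ 2) xL xR).
  pose (rho1 := fun s => RInt (fun x => (a1 s x + phi s x * e0 s x) ^ 2) xL xR).
  pose (d0 := fun s => (e0 s xL - e0 s xR) ^ 2).
  pose (d1 := fun s => (e1 s xL - e1 s xR) ^ 2).
  pose (N := fun s x => e0 s x ^ 2 + e1 s x ^ 2).
  pose (F := fun s => RInt (Q s) xL xR).
  (* The estimate first produces C + g/2 in front of the integral of [N]; the bound of that integral
     by 4 F turns this into [k]. *)
  pose (k := fun s => 4 * C + 2 * g s).
  pose (h := fun s => rho0 s + rho1 s + d0 s + d1 s + g s).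
  destruct H0 as [He0 Ha0 Hb0 _ _]. destruct H1 as [He1 Ha1 Hb1 _ _].
  destruct Hq as [Hqc _ _ _ _].
  assert (HQt := C1_jcont_t _ _ _ _ _ _ HQ).
  assert (HQc := C1_jcont _ _ _ _ _ _ HQ).
  assert (Hbdx := C1_jcont_x _ _ _ _ _ _ Hbd).
  assert (Htrx := C1_jcont_x _ _ _ _ _ _ Htr).
  assert (HN : jcont N) by (unfold N; jc).
  assert (hg : forall s, continuous g s).
  { intros s. apply continuous_sqrt_comp.
    apply (continuous_RInt_param (fun s x => b0 s x ^ 2)); [exact hx'|jc]. }
  assert (hrho0 : forall s, continuous rho0 s).
  { intros s. apply (continuous_RInt_param (fun s x => (a0 s x + b1 s x) ^ 2)); [exact hx'|jc]. }
  assert (hrho1 : forall s, continuous rho1 s).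
  { intros s.
    apply (continuous_RInt_param (fun s x => (a1 s x + phi s x * e0 s x) ^ 2)); [exact hx'|jc]. }
  assert (hd0 : forall s, continuous d0 s).
  { apply (continuous_sq (fun s => e0 s xL - e0 s xR)). intros s.
    apply (continuous_minus (V := R_NormedModule)); now apply jcont_continuous_fst. }
  assert (hd1 : forall s, continuous d1 s).
  { apply (continuous_sq (fun s => e1 s xL - e1 s xR)). intros s.
    apply (continuous_minus (V := R_NormedModule)); now apply jcont_continuous_fst. }
  assert (hg0 : forall s, 0 <= g s) by (intros; apply sqrt_pos).
  assert (hsq : forall f : R -> R -> R, jcont f ->
    forall s, 0 <= RInt (fun x => f s x ^ 2) xL xR).
  { intros f hf s. apply RInt_ge_0; [exact hx'| |intros; apply pow2_ge_0].
    apply (ex_RInt_jcont (fun s x => f s x ^ 2)). jc. }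
  assert (hrho0p : forall s, 0 <= rho0 s) by (intros s; apply (hsq (fun s x => a0 s x + b1 s x)); jc).
  assert (hrho1p : forall s, 0 <= rho1 s)
    by (intros s; apply (hsq (fun s x => a1 s x + phi s x * e0 s x)); jc).
  assert (hB0 : 0 <= B).
  { apply Rle_trans with (2 := hB 0 xL ltac:(lra)). apply Rabs_pos. }
  assert (hNQ : forall s, RInt (N s) xL xR <= 4 * F s).
  { intros s. unfold F. rewrite <- RInt_scalR by (now apply ex_RInt_jcont).
    apply RInt_le; [exact hx'|now apply ex_RInt_jcont| |].
    - apply (ex_RInt_scal (V := R_NormedModule)). now apply ex_RInt_jcont.
    - intros x hxx. specialize (hq x ltac:(lra)). unfold N, Q.
      assert (hm := mult_le_weighted 1 (- q x) (e0 s x) (e1 s x)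
        ltac:(apply Rabs_le; lra)). lra. }
  assert (hQN : forall s, F s <= 3 / 4 * RInt (N s) xL xR).
  { intros s. unfold F. rewrite <- RInt_scalR by (now apply ex_RInt_jcont).
    apply RInt_le; [exact hx'|now apply ex_RInt_jcont| |].
    - apply (ex_RInt_scal (V := R_NormedModule)). now apply ex_RInt_jcont.
    - intros x hxx. specialize (hq x ltac:(lra)). unfold N, Q.
      assert (hm := mult_le_weighted 1 (q x) (e0 s x) (e1 s x)
        ltac:(apply Rabs_le; lra)). lra. }
  assert (hmain : forall s, RInt (Qt s) xL xR <= k s * F s + h s).
  { intros s.
    (* Traces are traded for interior integrals through the multiplier q: the
       primitive bd produces -e1(xR)^2/4, which absorbs the boundary term
       (e0(xL) - e0(xR)) e1(xR), and tr expresses e0(xL)^2. *)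
    assert (hbd := C1_rect_RInt_dx _ _ _ s _ _ _ hx' Hbd).
    assert (htr := C1_rect_RInt_dx _ _ _ s _ _ _ hx' Htr).
    unfold bd in hbd. unfold tr in htr. rewrite hqL, hqR in hbd, htr.
    pose (R1 := fun x => C * N s x + (a0 s x + b1 s x) ^ 2 + (a1 s x + phi s x * e0 s x) ^ 2).
    (* The factor of [b0] in -1/2 [trx]. Since |w| <= |e0|, the two products with [b0], by [e1] and
       by [w], together cost at most g + g/2 times the integral of [N]. *)
    pose (w := fun s x => -1 * (1 - q x) * e0 s x).
    assert (Hw : jcont w) by (unfold w; jc).
    assert (hle : RInt (fun x => Qt s x + bdx s x - 1 / 2 * trx s x) xL xR <=
      RInt (fun x => R1 x + b0 s x * e1 s x + b0 s x * w s x) xL xR).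
    { apply RInt_le; [exact hx'| | |].
      - apply (ex_RInt_jcont (fun s x => Qt s x + bdx s x - 1 / 2 * trx s x)). jc.
      - apply (ex_RInt_jcont (fun s x => C * N s x + (a0 s x + b1 s x) ^ 2
          + (a1 s x + phi s x * e0 s x) ^ 2 + b0 s x * e1 s x + b0 s x * w s x)). jc.
      - intros x hxx. specialize (hq x ltac:(lra)). specialize (hB s x ltac:(lra)).
        unfold R1, w, Qt, bdx, trx, N, C.
        set (r0 := a0 s x + b1 s x). set (r1 := a1 s x + phi s x * e0 s x).
        (* After these substitutions the terms in [b1] cancel and those in [b0] are the same on both
           sides. Each remaining mixed product is bounded by one of [m1] to [m6]. *)
        replace (a0 s x) with (r0 - b1 s x) by (unfold r0; ring).
        replace (a1 s x) with (r1 - phi s x * e0 s x) by (unfold r1; ring).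
        assert (m1 := mult_le_weighted 1 1 (e0 s x) r0 ltac:(rewrite Rabs_R1; lra)).
        assert (m2 := mult_le_weighted 1 1 (e1 s x) r1 ltac:(rewrite Rabs_R1; lra)).
        assert (hq2 : Rabs (1 / 2 * q x) <= 1 / 2) by (apply Rabs_le; lra).
        assert (m3 := mult_le_weighted _ _ (e1 s x) r0 hq2).
        assert (m4 := mult_le_weighted _ _ (e0 s x) r1 hq2).
        assert (m5 := mult_le_weighted B (- phi s x) (e0 s x) (e1 s x)
          ltac:(rewrite Rabs_Ropp; exact hB)).
        assert (m6 := mult_le_weighted (1 / 2 * B) (- (1 / 2 * q x * phi s x)) (e0 s x) (e0 s x)
          ltac:(rewrite Rabs_Ropp, Rabs_mult;
                apply Rmult_le_compat; auto using Rabs_pos)).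
        assert (0 <= e0 s x ^ 2) by apply pow2_ge_0.
        assert (0 <= e1 s x ^ 2) by apply pow2_ge_0.
        assert (0 <= r0 ^ 2) by apply pow2_ge_0.
        assert (0 <= r1 ^ 2) by apply pow2_ge_0.
        assert (0 <= iL * e0 s x ^ 2) by nra.
        assert (0 <= iL * e1 s x ^ 2) by nra.
        assert (0 <= B * e0 s x ^ 2) by nra.
        assert (0 <= B * e1 s x ^ 2) by nra.
        lra. }
    assert (hlhs : RInt (fun x => Qt s x + bdx s x - 1 / 2 * trx s x) xL xR =
      RInt (Qt s) xL xR + RInt (bdx s) xL xR - 1 / 2 * RInt (trx s) xL xR).
    { rewrite (RInt_minusR (fun x => Qt s x + bdx s x) (fun x => 1 / 2 * trx s x)),
        (RInt_plusR (Qt s) (bdx s)), (RInt_scalR (trx s)); auto using ex_RInt_jcont.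
      - apply ex_RInt_plusR; now apply ex_RInt_jcont.
      - apply ex_RInt_scalR; now apply ex_RInt_jcont. }
    rewrite hlhs, hbd, htr in hle. clear hlhs.
    assert (hrhs : RInt (fun x => R1 x + b0 s x * e1 s x + b0 s x * w s x) xL xR =
      C * RInt (N s) xL xR + rho0 s + rho1 s
      + RInt (fun x => b0 s x * e1 s x) xL xR + RInt (fun x => b0 s x * w s x) xL xR).
    { assert (J1 : ex_RInt (fun x => b0 s x * e1 s x) xL xR)
        by (apply (ex_RInt_jcont (fun s x => b0 s x * e1 s x)); jc).
      assert (J2 : ex_RInt (fun x => b0 s x * w s x) xL xR)
        by (apply (ex_RInt_jcont (fun s x => b0 s x * w s x)); jc).
      assert (J3 : ex_RInt (fun x => (a0 s x + b1 s x) ^ 2) xL xR)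
        by (apply (ex_RInt_jcont (fun s x => (a0 s x + b1 s x) ^ 2)); jc).
      assert (J4 : ex_RInt (fun x => (a1 s x + phi s x * e0 s x) ^ 2) xL xR)
        by (apply (ex_RInt_jcont (fun s x => (a1 s x + phi s x * e0 s x) ^ 2)); jc).
      assert (J5 : ex_RInt (fun x => C * N s x) xL xR)
        by (apply ex_RInt_scalR; now apply ex_RInt_jcont).
      assert (J6 := ex_RInt_plusR _ _ _ _ J5 J3).
      assert (J7 := ex_RInt_plusR _ _ _ _ J6 J4).
      assert (J8 := ex_RInt_plusR _ _ _ _ J7 J1).
      unfold R1, rho0, rho1.
      rewrite (RInt_plusR _ _ _ _ J8 J2), (RInt_plusR _ _ _ _ J7 J1),
        (RInt_plusR _ _ _ _ J6 J4), (RInt_plusR _ _ _ _ J5 J3).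
      rewrite (RInt_scalR (N s)) by (now apply ex_RInt_jcont). reflexivity. }
    rewrite hrhs in hle. clear hrhs.
    assert (hc1 := RInt_mult_le_L2norm (b0 s) (e1 s) xL xR hx'
      (fun x => jcont_continuous_snd _ s x Hb0) (fun x => jcont_continuous_snd _ s x He1)).
    assert (hc2 := RInt_mult_le_L2norm (b0 s) (w s) xL xR hx'
      (fun x => jcont_continuous_snd _ s x Hb0) (fun x => jcont_continuous_snd _ s x Hw)).
    fold (g s) in hc1, hc2.
    assert (hw : RInt (fun x => w s x ^ 2) xL xR <= RInt (fun x => e0 s x ^ 2) xL xR).
    { apply RInt_le; [exact hx'| | |].
      - apply (ex_RInt_jcont (fun s x => w s x ^ 2)). jc.
      - apply (ex_RInt_jcont (fun s x => e0 s x ^ 2)). jc.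
      - intros x hxx. specialize (hq x ltac:(lra)). unfold w.
        replace ((-1 * (1 - q x) * e0 s x) ^ 2) with ((1 - q x) ^ 2 * e0 s x ^ 2) by ring.
        assert (0 <= e0 s x ^ 2) by apply pow2_ge_0.
        assert ((1 - q x) ^ 2 <= 1) by nra. nra. }
    assert (hN2 : RInt (N s) xL xR =
      RInt (fun x => e0 s x ^ 2) xL xR + RInt (fun x => e1 s x ^ 2) xL xR).
    { unfold N. apply RInt_plusR.
      - apply (ex_RInt_jcont (fun s x => e0 s x ^ 2)). jc.
      - apply (ex_RInt_jcont (fun s x => e1 s x ^ 2)). jc. }
    assert (hgw : g s / 2 * (1 + RInt (fun x => e1 s x ^ 2) xL xR) +
       g s / 2 * (1 + RInt (fun x => w s x ^ 2) xL xR) <=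
       g s + g s / 2 * RInt (N s) xL xR).
    { rewrite hN2. specialize (hg0 s). nra. }
    assert (hNF : (C + g s / 2) * RInt (N s) xL xR <= (C + g s / 2) * (4 * F s)).
    { apply Rmult_le_compat_l; [|apply hNQ]. specialize (hg0 s). unfold C. lra. }
    clear - hle hc1 hc2 hgw hNF.
    unfold k, h, d0, d1.
    (* Write j0 and j1 for the jumps, the value at [xL] minus the value at [xR]. The boundary terms
       are j0 e1(xR) + e0(xL) j1. The first square bounds j0 e1(xR) by j0^2 + e1(xR)^2/4, the second
       bounds e0(xL) j1 by e0(xL)^2/2 + j1^2/2; the traces are exactly those provided by [bd] and
       1/2 [tr]. *)
    assert (0 <= ((e0 s xL - e0 s xR) - 1 / 2 * e1 s xR) ^ 2) by apply pow2_ge_0.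
    assert (0 <= (e0 s xL + (e1 s xR - e1 s xL)) ^ 2) by apply pow2_ge_0.
    assert (0 <= (e1 s xL - e1 s xR) ^ 2) by apply pow2_ge_0.
    lra. }
  assert (hgr := gronwall F (fun s => RInt (Qt s) xL xR) k h t ltac:(lra)).
  assert (hF : forall s, continuous F s) by (intros s; now apply continuous_RInt_param).
  assert (hk : forall s, continuous k s).
  { intros s. apply (continuous_plus (V := R_NormedModule)); [apply continuous_const|].
    apply (continuous_scal_r (V := R_NormedModule) 2 g), hg. }
  assert (hrr : forall s, continuous (fun s => rho0 s + rho1 s) s)
    by (intros s; now apply (continuous_plus (V := R_NormedModule))).
  assert (hrd : forall s, continuous (fun s => rho0 s + rho1 s + d0 s) s)
    by (intros s; now apply (continuous_plus (V := R_NormedModule))).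
  assert (hrdd : forall s, continuous (fun s => rho0 s + rho1 s + d0 s + d1 s) s)
    by (intros s; now apply (continuous_plus (V := R_NormedModule))).
  assert (hh : forall s, continuous h s)
    by (intros s; now apply (continuous_plus (V := R_NormedModule))).
  specialize (hgr hF hk hh).
  assert (hk0 : forall s, 0 <= k s) by (intros s; specialize (hg0 s); unfold k, C; lra).
  assert (hh0 : forall s, 0 <= h s).
  { intros s. unfold h, d0, d1. specialize (hg0 s). specialize (hrho0p s). specialize (hrho1p s).
    assert (0 <= (e0 s xL - e0 s xR) ^ 2) by apply pow2_ge_0.
    assert (0 <= (e1 s xL - e1 s xR) ^ 2) by apply pow2_ge_0. lra. }
  specialize (hgr hk0 hh0).
  assert (hder : forall s, 0 < s < t -> is_derive F s (RInt (Qt s) xL xR)).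
  { intros s hs. apply (is_derive_RInt_jcont Q Qt T); auto; [|lra].
    apply (C1_der_t _ _ _ _ _ _ HQ). }
  specialize (hgr hder (fun s _ => hmain s)).
  assert (hkI : RInt k 0 t = 4 * C * t + 2 * RInt g 0 t).
  { unfold k.
    rewrite (RInt_plusR (fun _ => 4 * C) (fun s => 2 * g s)), (RInt_scalR g);
      try (now apply ex_RInt_cont).
    - assert (RInt (fun _ : R => 4 * C) 0 t = (t - 0) * (4 * C)) as ->
        by exact (RInt_const (V := R_CompleteNormedModule) 0 t (4 * C)).
      simpl. ring.
    - apply ex_RInt_cont. intros; apply continuous_const.
    - apply ex_RInt_scalR. now apply ex_RInt_cont. }
  assert (hhI : RInt h 0 t =
    RInt rho0 0 t + RInt rho1 0 t + RInt d0 0 t + RInt d1 0 t + RInt g 0 t).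
  { unfold h. rewrite !RInt_plusR; try reflexivity; now apply ex_RInt_cont. }
  fold rho0 rho1 d0 d1 g. fold C. fold (N t) (N 0).
  rewrite <- hkI.
  rewrite <- hhI.
  specialize (hQN 0). specialize (hNQ t).
  assert (0 < exp (RInt k 0 t)) by apply exp_pos.
  apply Rle_trans with (1 := hNQ).
  apply Rle_trans with (4 * (exp (RInt k 0 t) * (F 0 + RInt h 0 t))); [lra|].
  replace (4 * (exp (RInt k 0 t) * (F 0 + RInt h 0 t))) with
    (exp (RInt k 0 t) * (4 * F 0 + 4 * RInt h 0 t)) by ring.
  apply Rmult_le_compat_l; lra.
Qed.

(** * Regularity of networks *)

(** The derivatives of a network are never written out; only their existence and continuity are
    carried through the layers. *)
Definition ex_C1_rect (T xL xR : R) (f : R -> R -> R) : Prop :=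
  exists ft fx, C1_rect T xL xR f ft fx.

Lemma ex_C1_rect_const (T xL xR c : R) : ex_C1_rect T xL xR (fun _ _ => c).
Proof. eexists _, _. apply C1_rect_const. Qed.

Lemma ex_C1_rect_plus (T xL xR : R) (f g : R -> R -> R) :
  ex_C1_rect T xL xR f -> ex_C1_rect T xL xR g ->
  ex_C1_rect T xL xR (fun t x => f t x + g t x).
Proof. intros [ft [fx hf]] [gt [gx hg]]. eexists _, _. apply C1_rect_plus; eassumption. Qed.

Lemma ex_C1_rect_mult (T xL xR : R) (f g : R -> R -> R) :
  ex_C1_rect T xL xR f -> ex_C1_rect T xL xR g ->
  ex_C1_rect T xL xR (fun t x => f t x * g t x).
Proof. intros [ft [fx hf]] [gt [gx hg]]. eexists _, _. apply C1_rect_mult; eassumption. Qed.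

Lemma ex_C1_rect_comp (T xL xR : R) (s : R -> R) (f : R -> R -> R) :
  (forall y, ex_derive s y /\ continuous (Derive s) y) ->
  ex_C1_rect T xL xR f -> ex_C1_rect T xL xR (fun t x => s (f t x)).
Proof. intros hs [ft [fx hf]]. eexists _, _. apply C1_rect_comp; eassumption. Qed.

Lemma ex_C1_rect_ext (T xL xR : R) (f g : R -> R -> R) :
  (forall t x, f t x = g t x) -> ex_C1_rect T xL xR f -> ex_C1_rect T xL xR g.
Proof.
  intros h [ft [fx hf]]. exists ft, fx.
  now apply (C1_rect_ext _ _ _ _ _ _ _ _ _ hf h).
Qed.

Lemma ex_C1_rect_sum_n (T xL xR : R) (f : nat -> R -> R -> R) (n : nat) :
  (forall i, ex_C1_rect T xL xR (f i)) ->
  ex_C1_rect T xL xR (fun t x => sum_n (fun i => f i t x) n).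
Proof.
  intros hf. induction n as [|n IH].
  - apply ex_C1_rect_ext with (f 0%nat); [|apply hf].
    intros t x. now rewrite sum_O.
  - apply ex_C1_rect_ext with (fun t x => sum_n (fun i => f i t x) n + f (S n) t x).
    + intros t x. now rewrite sum_Sn.
    + now apply ex_C1_rect_plus.
Qed.

Lemma coeff_Tn_out {A : Type} (x0 : A) (n : nat) (v : Tn n A) (i : nat) :
  (n <= i)%nat -> coeff_Tn x0 v i = x0.
Proof.
  revert v i. induction n as [|n IH]; intros v i hi; [reflexivity|].
  destruct i as [|i]; [lia|]. simpl. apply IH. lia.
Qed.

Lemma coeff_mat_out {A : Type} (x0 : A) (m n : nat) (M : @matrix A m n) (i j : nat) :
  (m <= i \/ n <= j)%nat -> coeff_mat x0 M i j = x0.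
Proof.
  intros h. unfold coeff_mat. destruct (Nat.le_gt_cases n j) as [hj|hj].
  - now apply coeff_Tn_out.
  - rewrite (coeff_Tn_out _ m) by lia. now rewrite coeff_Tn_bij.
Qed.

(** All indices are allowed: out of range the coefficient is the default value 0, a constant, so no
    index bounds have to be carried along. *)
Definition C1_matrix (T xL xR : R) {m n : nat} (v : R -> R -> @matrix R m n) : Prop :=
  forall i j, ex_C1_rect T xL xR (fun t x => coeff_mat 0 (v t x) i j).

Lemma C1_matrix_mk (T xL xR : R) (m n : nat) (u : R -> R -> nat -> nat -> R) :
  (forall i j, ex_C1_rect T xL xR (fun t x => u t x i j)) ->
  C1_matrix T xL xR (fun t x => mk_matrix m n (u t x)).
Proof.
  intros hu i j. destruct (Nat.le_gt_cases m i) as [hi|hi];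
    [|destruct (Nat.le_gt_cases n j) as [hj|hj]].
  - apply ex_C1_rect_ext with (fun _ _ => 0); [|apply ex_C1_rect_const].
    intros t x. now rewrite coeff_mat_out by auto.
  - apply ex_C1_rect_ext with (fun _ _ => 0); [|apply ex_C1_rect_const].
    intros t x. now rewrite coeff_mat_out by auto.
  - apply ex_C1_rect_ext with (fun t x => u t x i j); [|apply hu].
    intros t x. now rewrite coeff_mat_bij.
Qed.

Lemma C1_matrix_affine (T xL xR : R) (m n : nat) (W : @matrix R n m)
    (b : @matrix R n 1) (v : R -> R -> @matrix R m 1) :
  C1_matrix T xL xR v -> C1_matrix T xL xR (fun t x => affine W b (v t x)).
Proof.
  intros hv. apply (C1_matrix_mk T xL xR n 1 (fun t x i j =>
    plus (coeff_mat zero (Mmult W (v t x)) i j) (coeff_mat zero b i j))).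
  intros i j. apply ex_C1_rect_plus; [|apply ex_C1_rect_const].
  (* The product [Mmult] is itself built by [mk_matrix], with entries that are sums of products up
     to the index [pred m]. *)
  apply (C1_matrix_mk T xL xR n 1 (fun t x i j =>
    sum_n (fun l => mult (coeff_mat zero W i l) (coeff_mat zero (v t x) l j)) (Init.Nat.pred m))).
  clear i j. intros i j.
  apply (ex_C1_rect_sum_n T xL xR (fun l t x => coeff_mat 0 W i l * coeff_mat 0 (v t x) l j)).
  intros l. apply ex_C1_rect_mult; [apply ex_C1_rect_const|apply hv].
Qed.

Lemma ex_C1_rect_eval (T xL xR : R) (sigma : R -> R) (m : nat) (N : network m)
    (v : R -> R -> @matrix R m 1) :
  (forall y, ex_derive sigma y /\ continuous (Derive sigma) y) ->
  C1_matrix T xL xR v -> ex_C1_rect T xL xR (fun t x => eval sigma N (v t x)).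
Proof.
  (* The input [v] is generalised because the rest of the network receives the output of the first
     hidden layer. *)
  intros hs. revert v. induction N as [m W b|m n W b N IH]; intros v hv; simpl.
  - now apply C1_matrix_affine.
  - apply IH. apply (C1_matrix_mk T xL xR (S n) 1 (fun t x i j =>
      sigma (coeff_mat 0 (affine W b (v t x)) i j))).
    intros i j. apply ex_C1_rect_comp; [exact hs|]. now apply C1_matrix_affine.
Qed.

Lemma ex_C1_rect_realize (T xL xR : R) (sigma : R -> R) (N : network 2) :
  (forall y, ex_derive sigma y /\ continuous (Derive sigma) y) ->
  ex_C1_rect T xL xR (realize sigma N).
Proof.
  intros hs. apply (ex_C1_rect_eval T xL xR sigma 2 N _ hs).
  apply (C1_matrix_mk T xL xR 2 1 (fun t x i _ => match i with O => t | _ => x end)).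
  intros [|i] _.
  - eexists (fun _ _ => 1), (fun _ _ => 0). split; try apply jcont_const.
    + apply jcont_fst.
    + intros t x _. apply (is_derive_id (K := R_AbsRing)).
    + intros t x _. apply (is_derive_const (V := R_NormedModule)).
  - eexists (fun _ _ => 0), (fun _ _ => 1). split; try apply jcont_const.
    + apply jcont_snd.
    + intros t x _. apply (is_derive_const (V := R_NormedModule)).
    + intros t x _. apply (is_derive_id (K := R_AbsRing)).
Qed.

(** * Extension from the closed rectangle *)

(** At an interior point the filters [within (Icc a b) (locally x)] and [locally x] contain the same
    sets, and [filterdiff] depends on its filter only through these. *)
Lemma is_derive_on_interior (a b : R) (f : R -> R) (x l : R) :
  a < x < b -> is_derive_on (Icc a b) f x l <-> is_derive f x l.
Proof.
  intros hx.
  assert (hle : forall P, within (Icc a b) (locally x) P <-> locally x P).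
  { intros P. split.
    - intros h.
      assert (locally x (fun y => a < y < b)) as hab.
      { apply filter_and; [apply open_gt|apply open_lt]; lra. }
      unfold within in h. generalize (filter_and _ _ hab h). apply filter_imp.
      intros y [h2 h1]. apply h1. unfold Icc. lra.
    - intros h. unfold within. revert h. apply filter_imp. auto. }
  split; intros [hl h]; (split; [exact hl|]); intros y hy eps.
  - apply hle, h. intros P hP. now apply hle, hy.
  - apply hle, h. intros P hP. now apply hle, hy.
Qed.

Lemma Derive_on_interior (a b : R) (f : R -> R) (x l : R) :
  a < x < b -> is_derive f x l -> Derive_on (Icc a b) f x = l.
Proof.
  intros hx hf.
  apply (iota_unique (V := R_CompleteNormedModule)
    (fun l : R => is_derive_on (Icc a b) f x l)).
  - intros y hy. apply is_derive_on_interior in hy; [|exact hx].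
    transitivity (Derive f x); [symmetry|]; now apply is_derive_unique.
  - now apply is_derive_on_interior.
Qed.

Lemma is_derive_Derive_on (a b : R) (f : R -> R) (x : R) :
  a < x < b -> ex_derive_on (Icc a b) f x -> is_derive f x (Derive_on (Icc a b) f x).
Proof.
  intros hx [l hl]. apply is_derive_on_interior in hl; [|exact hx].
  now rewrite (Derive_on_interior a b f x l hx hl).
Qed.

(** * Projection of the plane onto the rectangle *)

Definition clamp (a b x : R) : R := Rmax a (Rmin b x).

Lemma clamp_id (a b x : R) : a <= x <= b -> clamp a b x = x.
Proof. intros h. unfold clamp. rewrite Rmin_right, Rmax_right; lra. Qed.

Lemma clamp_Icc (a b x : R) : a <= b -> Icc a b (clamp a b x).
Proof.
  intros h. unfold clamp, Icc. split; [apply Rmax_l|].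
  apply Rmax_lub; [exact h|apply Rmin_l].
Qed.

Lemma clamp_lipschitz (a b x y : R) : Rabs (clamp a b x - clamp a b y) <= Rabs (x - y).
Proof.
  unfold clamp, Rmax, Rmin.
  repeat destruct Rle_dec; unfold Rabs; repeat destruct Rcase_abs; lra.
Qed.

Definition clamped (T xL xR : R) (f : R -> R -> R) (t x : R) : R :=
  f (clamp 0 T t) (clamp xL xR x).

Lemma clamped_K (T xL xR : R) (f : R -> R -> R) (t x : R) :
  K T xL xR (t, x) -> clamped T xL xR f t x = f t x.
Proof. intros [ht hx]. unfold clamped. now rewrite !clamp_id. Qed.

(** The projection is 1-Lipschitz in each coordinate, so a radius that works for [f] on K at the
    projected point works at the point itself. *)
Lemma jcont_clamped (T xL xR : R) (f : R -> R -> R) :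
  0 <= T -> xL <= xR ->
  continuous_on (K T xL xR) (fun z : R * R => f (fst z) (snd z)) ->
  jcont (clamped T xL xR f).
Proof.
  intros hT hx hf t x. apply continuity_2d_pt_filterlim.
  assert (hK : forall t x, K T xL xR (clamp 0 T t, clamp xL xR x)).
  { intros s y. split; now apply clamp_Icc. }
  apply (filterlim_comp _ _ _ (fun z : R * R => (clamp 0 T (fst z), clamp xL xR (snd z)))
    (fun z : R * R => f (fst z) (snd z)) _ _ _) with
    (2 := hf (clamp 0 T t, clamp xL xR x) (hK t x)).
  intros P [d hd]. exists d. intros [s y] [hs hy]. apply hd; [|apply hK].
  split.
  - apply Rle_lt_trans with (2 := hs). apply clamp_lipschitz.
  - apply Rle_lt_trans with (2 := hy). apply clamp_lipschitz.
Qed.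

Lemma Ck_1_der_t (T xL xR : R) (f : R -> R -> R) (t x : R) :
  Ck T xL xR 1 f -> 0 < t < T -> xL <= x <= xR ->
  is_derive (fun s => f s x) t (dt T f t x).
Proof.
  intros [_ [hd _]] ht hx. apply is_derive_Derive_on; [exact ht|].
  apply hd. split; unfold Icc; simpl; lra.
Qed.

Lemma Ck_1_der_x (T xL xR : R) (f : R -> R -> R) (t x : R) :
  Ck T xL xR 1 f -> 0 <= t <= T -> xL < x < xR ->
  is_derive (f t) x (dx xL xR f t x).
Proof.
  intros [_ [hd _]] ht hx. apply (is_derive_Derive_on _ _ (f t)); [exact hx|].
  apply hd. split; unfold Icc; simpl; lra.
Qed.

(** When one variable is interior, clamping is the identity near it, while the other variable is
    frozen at its projection, possibly an end point. The derivative of the extension is thus the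
    extension of the derivative. *)
Lemma C1_rect_clamped (T xL xR : R) (f : R -> R -> R) :
  0 <= T -> xL <= xR -> Ck T xL xR 1 f ->
  C1_rect T xL xR (clamped T xL xR f) (clamped T xL xR (dt T f))
    (clamped T xL xR (dx xL xR f)).
Proof.
  intros hT hx hC. assert (hC' := hC). destruct hC' as [h0 [_ [[h1 _] [h2 _]]]].
  split; try now apply jcont_clamped.
  - intros t x ht. unfold clamped at 2. rewrite (clamp_id 0 T t) by lra.
    assert (hcx := clamp_Icc xL xR x hx).
    apply is_derive_ext_loc with (fun s => f s (clamp xL xR x)).
    + assert (locally t (fun s => 0 < s < T)) as hab.
      { apply filter_and; [apply open_gt|apply open_lt]; lra. }
      revert hab. apply filter_imp. intros s hs. unfold clamped.
      now rewrite (clamp_id 0 T s) by lra.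
    + now apply (Ck_1_der_t T xL xR).
  - intros t x hx'. unfold clamped at 2. rewrite (clamp_id xL xR x) by lra.
    assert (hct := clamp_Icc 0 T t hT).
    apply is_derive_ext_loc with (f (clamp 0 T t)).
    + assert (locally x (fun y => xL < y < xR)) as hab.
      { apply filter_and; [apply open_gt|apply open_lt]; lra. }
      revert hab. apply filter_imp. intros y hy. unfold clamped.
      now rewrite (clamp_id xL xR y) by lra.
    + now apply (Ck_1_der_x T xL xR).
Qed.

(** * From the energy estimate to the loss *)

Lemma jcont_bounded (a b c d : R) (f : R -> R -> R) :
  a <= b -> c <= d -> jcont f ->
  exists B, forall t x, a <= t <= b -> c <= x <= d -> Rabs (f t x) <= B.
Proof.
  intros hab hcd hf.
  destruct (uniform_continuity_2d f a b c d (fun s x _ _ => hf s x) (mkposreal 1 Rlt_0_1))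
    as [del hdel]. simpl in hdel.
  (* The segment from the corner (a,c) to (t,x) is walked in [n] equal steps, each shorter than
     [del] in both coordinates, hence changing [f] by less than 1. As [n] does not depend on (t,x),
     |f(a,c)| + n is a bound. *)
  destruct (archimed_cor1 (del / (b - a + (d - c) + 1))) as [n [hn hn0]].
  { apply Rdiv_lt_0_compat; [apply del|lra]. }
  assert (hn0' : 0 < INR n) by (now apply lt_0_INR).
  assert (hstep : (b - a + (d - c) + 1) * / INR n < del).
  { apply Rmult_lt_reg_r with (/ (b - a + (d - c) + 1)).
    - apply Rinv_0_lt_compat. lra.
    - replace (_ * / INR n * _) with (/ INR n) by (field; lra). exact hn. }
  set (h := / INR n) in *.
  assert (hh : 0 < h) by (now apply Rinv_0_lt_compat).
  assert (hnh : INR n * h = 1) by (unfold h; field; lra).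
  exists (Rabs (f a c) + INR n). intros t x ht hx.
  assert (hk : forall k, (k <= n)%nat ->
    Rabs (f (a + INR k * h * (t - a)) (c + INR k * h * (x - c))) <= Rabs (f a c) + INR k).
  { induction k as [|k IH]; intros hk.
    - simpl. rewrite !Rmult_0_l, !Rplus_0_r. lra.
    - specialize (IH ltac:(lia)).
      assert (hk1 : INR (S k) * h <= 1).
      { rewrite <- hnh. apply Rmult_le_compat_r; [lra|]. now apply le_INR. }
      assert (hk0 : 0 <= INR k) by apply pos_INR.
      assert (0 <= INR k * h) by nra.
      rewrite S_INR in *.
      assert (hd := hdel (a + INR k * h * (t - a)) (c + INR k * h * (x - c))
        (a + (INR k + 1) * h * (t - a)) (c + (INR k + 1) * h * (x - c))).
      assert (Rabs (f (a + (INR k + 1) * h * (t - a)) (c + (INR k + 1) * h * (x - c)) -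
        f (a + INR k * h * (t - a)) (c + INR k * h * (x - c))) < 1).
      { apply hd; try nra.
        - replace (_ - _) with (h * (t - a)) by ring. rewrite Rabs_pos_eq; nra.
        - replace (_ - _) with (h * (x - c)) by ring. rewrite Rabs_pos_eq; nra. }
      revert H0 IH.
      generalize (f (a + (INR k + 1) * h * (t - a)) (c + (INR k + 1) * h * (x - c))).
      generalize (f (a + INR k * h * (t - a)) (c + INR k * h * (x - c))).
      intros u v huv hu. assert (Rabs v <= Rabs (v - u) + Rabs u).
      { replace v with ((v - u) + u) at 1 by ring. apply Rabs_triang. }
      lra. }
  specialize (hk n (le_n n)). rewrite hnh in hk.
  replace (a + 1 * (t - a)) with t in hk by ring.
  now replace (c + 1 * (x - c)) with x in hk by ring.
Qed.

(** The moment system removes [G] and turns the residuals of the errors into the integrands of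
    [loss_GE]; periodicity does the same for the jumps and [loss_BC]. The constants [A] and [D] are
    fixed before [p0] and [p1], so they serve a whole sequence of networks. *)
Lemma energy_le_loss (T xL xR lambda1 lambda2 : R) (Phi G m0 m1 : R -> R -> R)
    (hT : 0 < T) (hOmega : xL < xR)
    (hlambda1 : 0 < lambda1) (hlambda2 : 0 < lambda2)
    (hPhi : Ck T xL xR 1 Phi)
    (hm0 : Ck T xL xR 1 m0) (hm1 : Ck T xL xR 1 m1)
    (heq0 : forall t x : R, K T xL xR (t, x) ->
       dt T m0 t x + dx xL xR m1 t x = 0)
    (heq1 : forall t x : R, K T xL xR (t, x) ->
       dt T m1 t x + G t x = - m0 t x * dx xL xR Phi t x)
    (hper0 : forall t : R, 0 <= t <= T -> m0 t xL = m0 t xR)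
    (hper1 : forall t : R, 0 <= t <= T -> m1 t xL = m1 t xR) :
  exists A D, forall (t : R) (p0 p1 : R -> R -> R), 0 <= t <= T ->
    ex_C1_rect T xL xR p0 -> ex_C1_rect T xL xR p1 ->
    let l := loss_stage2 T xL xR lambda1 lambda2 Phi G m0 m1 p0 p1 in
    let n := norm_L1_H1dot xL xR t (fun s x => p0 s x - m0 s x) in
    0 <= energy xL xR m0 m1 p0 p1 t <= exp (A * t + 2 * n) * (D * l + 2 * n).
Proof.
  assert (hx : xL <= xR) by lra. assert (hT' : 0 <= T) by lra.
  pose (phi := clamped T xL xR (dx xL xR Phi)).
  assert (hphi : jcont phi).
  { destruct hPhi as [_ [_ [_ [h _]]]]. now apply jcont_clamped. }
  destruct (jcont_bounded 0 T xL xR phi hT' hx hphi) as [B hB].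
  (* The bound passes from [0,T] to all times because [phi] depends on [s] only through its
     projection. *)
  assert (hB' : forall s x, xL <= x <= xR -> Rabs (phi s x) <= B).
  { intros s x hxx.
    replace (phi s x) with (phi (clamp 0 T s) x).
    - apply hB; [|exact hxx]. now apply clamp_Icc.
    - unfold phi, clamped. rewrite (clamp_id 0 T (clamp 0 T s)); [reflexivity|].
      now apply clamp_Icc. }
  (* The second constant is half of 4 + 4/lambda1 + 3/lambda2: the residual part of the loss is at
     most [l], the jumps at most l/lambda1, the initial part at most l/lambda2, and [energy] carries
     a factor 1/2. *)
  exists (4 * (1 + B + / (xR - xL))), (2 + 2 / lambda1 + 3 / 2 / lambda2).
  intros t p0 p1 ht [p0t [p0x Hp0]] [p1t [p1x Hp1]] l n.
  assert (Hm0 := C1_rect_clamped _ _ _ _ hT' hx hm0).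
  assert (Hm1 := C1_rect_clamped _ _ _ _ hT' hx hm1).
  assert (H0 := C1_rect_minus _ _ _ _ _ _ _ _ _ Hp0 Hm0).
  assert (H1 := C1_rect_minus _ _ _ _ _ _ _ _ _ Hp1 Hm1).
  set (e0 := fun t x => p0 t x - clamped T xL xR m0 t x) in H0.
  set (a0 := fun t x => p0t t x - clamped T xL xR (dt T m0) t x) in H0.
  set (b0 := fun t x => p0x t x - clamped T xL xR (dx xL xR m0) t x) in H0.
  set (e1 := fun t x => p1 t x - clamped T xL xR m1 t x) in H1.
  set (a1 := fun t x => p1t t x - clamped T xL xR (dt T m1) t x) in H1.
  set (b1 := fun t x => p1x t x - clamped T xL xR (dx xL xR m1) t x) in H1.
  assert (hest := energy_estimate T xL xR B t phi e0 a0 b0 e1 a1 b1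
    hOmega ht hphi hB' H0 H1).
  assert (He0 := C1_jcont _ _ _ _ _ _ H0). assert (He1 := C1_jcont _ _ _ _ _ _ H1).
  assert (Ha0 := C1_jcont_t _ _ _ _ _ _ H0). assert (Ha1 := C1_jcont_t _ _ _ _ _ _ H1).
  assert (Hb0 := C1_jcont_x _ _ _ _ _ _ H0). assert (Hb1 := C1_jcont_x _ _ _ _ _ _ H1).
  assert (hK : forall s x, 0 <= s <= T -> xL <= x <= xR -> K T xL xR (s, x)) by (now split).
  assert (hE0 : forall s x, 0 <= s <= T -> xL <= x <= xR -> e0 s x = p0 s x - m0 s x).
  { intros s x hs hxx. unfold e0. now rewrite clamped_K by auto. }
  assert (hE1 : forall s x, 0 <= s <= T -> xL <= x <= xR -> e1 s x = p1 s x - m1 s x).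
  { intros s x hs hxx. unfold e1. now rewrite clamped_K by auto. }
  assert (hdt0 : forall s x, 0 < s < T -> dt T p0 s x = p0t s x).
  { intros s x hs. apply (Derive_on_interior 0 T (fun s => p0 s x)); [exact hs|].
    now apply (C1_der_t _ _ _ _ _ _ Hp0). }
  assert (hdt1 : forall s x, 0 < s < T -> dt T p1 s x = p1t s x).
  { intros s x hs. apply (Derive_on_interior 0 T (fun s => p1 s x)); [exact hs|].
    now apply (C1_der_t _ _ _ _ _ _ Hp1). }
  assert (hdx1 : forall s x, xL < x < xR -> dx xL xR p1 s x = p1x s x).
  { intros s x hs. apply (Derive_on_interior xL xR (p1 s)); [exact hs|].
    now apply (C1_der_x _ _ _ _ _ _ Hp1). }
  pose (r0 := fun s x => a0 s x + b1 s x).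
  pose (r1 := fun s x => a1 s x + phi s x * e0 s x).
  assert (Hr0 : jcont r0) by (unfold r0; jc).
  assert (Hr1 : jcont r1) by (unfold r1; jc).
  pose (d0 := fun s => e0 s xL - e0 s xR). pose (d1 := fun s => e1 s xL - e1 s xR).
  assert (hd0 : forall s, continuous d0 s).
  { intros s. apply (continuous_minus (V := R_NormedModule)); now apply jcont_continuous_fst. }
  assert (hd1 : forall s, continuous d1 s).
  { intros s. apply (continuous_minus (V := R_NormedModule)); now apply jcont_continuous_fst. }
  pose (ge0 := RInt (fun s => RInt (fun x => r0 s x ^ 2) xL xR) 0 T).
  pose (ge1 := RInt (fun s => RInt (fun x => r1 s x ^ 2) xL xR) 0 T).
  pose (bc0 := RInt (fun s => d0 s ^ 2) 0 T).
  pose (bc1 := RInt (fun s => d1 s ^ 2) 0 T).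
  pose (ic := RInt (fun x => e0 0 x ^ 2 + e1 0 x ^ 2) xL xR).
  (* [RInt_ext] compares integrands on open intervals only, where the derivatives relative to the
     closed intervals are ordinary ones. *)
  assert (hl : l = ge0 + ge1 + lambda1 * (bc0 + bc1) + lambda2 * ic).
  { unfold l, loss_stage2, loss_GE, loss_BC, loss_IC, ic.
    rewrite (RInt_plusR (fun x => e0 0 x ^ 2) (fun x => e1 0 x ^ 2));
      try (apply ex_RInt_cont, continuous_sq; intros x; now apply jcont_continuous_snd).
    f_equal; [f_equal; [f_equal|f_equal; f_equal]|f_equal; f_equal];
      apply RInt_ext; intros s hs; rewrite Rmin_left, Rmax_right in hs by lra.
    - apply RInt_ext. intros x hxx. rewrite Rmin_left, Rmax_right in hxx by lra.
      rewrite pow2_abs, hdt0, hdx1 by assumption. f_equal.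
      unfold r0, a0, b1. rewrite !clamped_K by (apply hK; lra).
      specialize (heq0 s x (hK s x ltac:(lra) ltac:(lra))). simpl. lra.
    - apply RInt_ext. intros x hxx. rewrite Rmin_left, Rmax_right in hxx by lra.
      rewrite pow2_abs, hdt1 by assumption. f_equal.
      unfold r1, a1, phi. rewrite hE0, !clamped_K by (try apply hK; lra).
      specialize (heq1 s x (hK s x ltac:(lra) ltac:(lra))). simpl. lra.
    - rewrite pow2_abs. unfold d0. rewrite !hE0, hper0 by lra. f_equal. simpl. ring.
    - rewrite pow2_abs. unfold d1. rewrite !hE1, hper1 by lra. f_equal. simpl. ring.
    - rewrite pow2_abs, hE0 by lra. reflexivity.
    - rewrite pow2_abs, hE1 by lra. reflexivity. }
  assert (hn : RInt (fun s => L2norm xL xR (b0 s)) 0 t = n).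
  { apply RInt_ext. intros s hs. rewrite Rmin_left, Rmax_right in hs by lra.
    unfold L2norm. f_equal. apply RInt_ext.
    intros x hxx. rewrite Rmin_left, Rmax_right in hxx by lra.
    rewrite pow2_abs. f_equal. symmetry. unfold b0. rewrite clamped_K by (apply hK; lra).
    apply (Derive_on_interior xL xR (fun y => p0 s y - m0 s y)); [exact hxx|].
    apply (is_derive_minus (V := R_NormedModule) (p0 s) (m0 s)).
    - now apply (C1_der_x _ _ _ _ _ _ Hp0).
    - apply (Ck_1_der_x T xL xR); auto; lra. }
  pose (N2 := RInt (fun x => e0 t x ^ 2 + e1 t x ^ 2) xL xR).
  assert (hen : energy xL xR m0 m1 p0 p1 t = 1 / 2 * N2).
  { unfold energy, N2. f_equal. apply RInt_ext.
    intros x hxx. rewrite Rmin_left, Rmax_right in hxx by lra.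
    now rewrite hE0, hE1 by lra. }
  assert (hpos : forall s, 0 <= RInt (fun x => e0 s x ^ 2 + e1 s x ^ 2) xL xR).
  { intros s. apply RInt_ge_0; [exact hx| |].
    - apply (ex_RInt_jcont (fun s x => e0 s x ^ 2 + e1 s x ^ 2)). jc.
    - intros x _. assert (h0 := pow2_ge_0 (e0 s x)). assert (h1 := pow2_ge_0 (e1 s x)). lra. }
  assert (hic : 0 <= ic) by apply hpos.
  assert (hN2 : 0 <= N2) by apply hpos.
  assert (hge0 : 0 <= ge0) by now apply RInt_RInt_sq_ge_0.
  assert (hge1 : 0 <= ge1) by now apply RInt_RInt_sq_ge_0.
  assert (hbc0 : 0 <= bc0) by now apply RInt_sq_ge_0.
  assert (hbc1 : 0 <= bc1) by now apply RInt_sq_ge_0.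
  rewrite hn in hest. fold N2 ic in hest.
  (* The estimate integrates up to [t], the loss up to [T]; the integrands are nonnegative. *)
  assert (hcut : forall f, jcont f -> RInt (fun s => RInt (fun x => f s x ^ 2) xL xR) 0 t <=
    RInt (fun s => RInt (fun x => f s x ^ 2) xL xR) 0 T).
  { intros f hf. apply RInt_nonneg_le; [exact ht| |].
    - intros s. now apply continuous_RInt_sq.
    - intros s. apply (RInt_sq_ge_0 (f s)); [exact hx|].
      intros x. now apply jcont_continuous_snd. }
  assert (hcutd : forall f, (forall s, continuous f s) ->
    RInt (fun s => f s ^ 2) 0 t <= RInt (fun s => f s ^ 2) 0 T).
  { intros f hf. apply RInt_nonneg_le; [exact ht|now apply continuous_sq|].
    intros s. apply pow2_ge_0. }
  assert (c0 := hcut r0 Hr0). assert (c1 := hcut r1 Hr1).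
  assert (c2 := hcutd d0 hd0). assert (c3 := hcutd d1 hd1).
  fold ge0 in c0. fold ge1 in c1. fold bc0 in c2. fold bc1 in c3.
  rewrite hen. split; [lra|].
  assert (hexp := exp_pos (4 * (1 + B + / (xR - xL)) * t + 2 * n)).
  assert (hlin : 3 * ic + 4 * (ge0 + ge1 + bc0 + bc1 + n) <=
    2 * ((2 + 2 / lambda1 + 3 / 2 / lambda2) * l + 2 * n)).
  { assert (hl0 : 0 <= ge0 + ge1 <= l) by (rewrite hl; nra).
    assert (hl1 : bc0 + bc1 <= l / lambda1).
    { apply Rmult_le_reg_l with lambda1; [exact hlambda1|].
      replace (lambda1 * (l / lambda1)) with l by (field; lra). rewrite hl. nra. }
    assert (hl2 : ic <= l / lambda2).
    { apply Rmult_le_reg_l with lambda2; [exact hlambda2|].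
      replace (lambda2 * (l / lambda2)) with l by (field; lra). rewrite hl. nra. }
    replace (2 * ((2 + 2 / lambda1 + 3 / 2 / lambda2) * l + 2 * n)) with
      (4 * l + 4 * (l / lambda1) + 3 * (l / lambda2) + 4 * n) by (field; lra).
    lra. }
  match goal with |- _ <= ?X * ?Y => cut (N2 <= X * (2 * Y)); [lra|] end.
  apply Rle_trans with (1 := hest).
  apply Rmult_le_compat_l; [lra|].
  apply Rle_trans with (2 := hlin).
  change (RInt (fun s => RInt (fun x => (a0 s x + b1 s x) ^ 2) xL xR) 0 t)
    with (RInt (fun s => RInt (fun x => r0 s x ^ 2) xL xR) 0 t).
  change (RInt (fun s => RInt (fun x => (a1 s x + phi s x * e0 s x) ^ 2) xL xR) 0 t)
    with (RInt (fun s => RInt (fun x => r1 s x ^ 2) xL xR) 0 t).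
  change (RInt (fun s => (e0 s xL - e0 s xR) ^ 2) 0 t) with (RInt (fun s => d0 s ^ 2) 0 t).
  change (RInt (fun s => (e1 s xL - e1 s xR) ^ 2) 0 t) with (RInt (fun s => d1 s ^ 2) 0 t).
  lra.
Qed.

Theorem theorem2 (T xL xR lambda1 lambda2 : R)
    (Phi G m0 m1 : R -> R -> R) (sigma : R -> R)
    (hT : 0 < T) (hOmega : xL < xR)
    (hlambda1 : 0 < lambda1) (hlambda2 : 0 < lambda2)
    (hPhi : smooth T xL xR Phi)
    (hm0 : Ck T xL xR 1 m0) (hm1 : Ck T xL xR 1 m1)
    (heq0 : forall t x : R, K T xL xR (t, x) ->
       dt T m0 t x + dx xL xR m1 t x = 0)
    (heq1 : forall t x : R, K T xL xR (t, x) ->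
       dt T m1 t x + G t x = - m0 t x * dx xL xR Phi t x)
    (hper0 : forall t : R, 0 <= t <= T -> m0 t xL = m0 t xR)
    (hper1 : forall t : R, 0 <= t <= T -> m1 t xL = m1 t xR)
    (hsigma : forall y : R, ex_derive sigma y /\ continuous (Derive sigma) y)
    (t : R) (ht : 0 <= t <= T)
    (N0 N1 : nat -> network 2)
    (hloss : is_lim_seq (fun j : nat =>
       loss_stage2 T xL xR lambda1 lambda2 Phi G m0 m1
         (realize sigma (N0 j)) (realize sigma (N1 j))) 0)
    (hnorm : is_lim_seq (fun j : nat =>
       norm_L1_H1dot xL xR t
         (fun s x : R => realize sigma (N0 j) s x - m0 s x)) 0) :
  is_lim_seq (fun j : nat =>
    energy xL xR m0 m1 (realize sigma (N0 j)) (realize sigma (N1 j)) t) 0.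
Proof.
  destruct (energy_le_loss T xL xR lambda1 lambda2 Phi G m0 m1 hT hOmega hlambda1 hlambda2
    (hPhi 1%nat) hm0 hm1 heq0 heq1 hper0 hper1) as [A [D hle]].
  set (l := fun j => loss_stage2 T xL xR lambda1 lambda2 Phi G m0 m1
         (realize sigma (N0 j)) (realize sigma (N1 j))) in hloss.
  set (n := fun j => norm_L1_H1dot xL xR t
         (fun s x : R => realize sigma (N0 j) s x - m0 s x)) in hnorm.
  (* Squeeze: [A] and [D] do not depend on [j], so the exponential tends to exp(A t) while the
     second factor tends to 0. *)
  apply is_lim_seq_le_le with (fun _ => 0)
    (fun j => exp (A * t + 2 * n j) * (D * l j + 2 * n j)).
  - intros j. apply hle; [exact ht| |]; now apply ex_C1_rect_realize.
  - apply is_lim_seq_const.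
  - replace 0 with (exp (A * t + 2 * 0) * (D * 0 + 2 * 0)) by ring.
    apply is_lim_seq_mult'.
    + apply (is_lim_seq_continuous exp (fun j => A * t + 2 * n j)).
      * apply derivable_continuous_pt, derivable_pt_exp.
      * apply is_lim_seq_plus'; [apply is_lim_seq_const|].
        apply (is_lim_seq_mult' (fun _ => 2) n); [apply is_lim_seq_const|exact hnorm].
    + apply is_lim_seq_plus'.
      * apply (is_lim_seq_mult' (fun _ => D) l); [apply is_lim_seq_const|exact hloss].
      * apply (is_lim_seq_mult' (fun _ => 2) n); [apply is_lim_seq_const|exact hnorm].
Qed.
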